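(* Let $G$ be a finite median graph. The following statements are equivalent: (i) $G$ is (isomorphic to) a simplex graph, i.e. $G\cong S(H)$ for some graph $H$; (ii) $G$ is (isomorphic to) a daisy cube; (iii) $G\in\mathscr{F}(P_4)$, i.e. $G$ does not have the path $P_4$ on four vertices as a partial cube-minor; (iv) every $\Theta$-class of $G$ is peripheral; (v) there exists a vertex $v\in V(G)$ such that $\deg(v)=\mathrm{idim}(G)$.
   Context: All graphs are finite, simple and undirected. For a graph $H$, a clique is a set of pairwise adjacent vertices (the empty set counts as a clique). The simplex graph $S(H)$ has as vertices all cliques of $H$ (including $\emptyset$), two cliques being adjacent iff they differ in exactly one vertex (i.e. one is obtained from the other by adding one vertex). $B^n$ is the set of binary strings of length $n$; the hypercube $Q_n$ has vertex set $B^n$, two strings adjacent iff they differ in exactly one coordinate. A partial cube is a graph isomorphic to an isometric subgraph of some $Q_n$ (distances in the subgraph equal Hamming distances); $\mathrm{idim}(G)$ is the least such $n$. A median graph is a connected graph in which every three vertices $u,v,w$ have exactly one vertex $x$ with $d(u,x)+d(x,v)=d(u,v)$, $d(u,x)+d(x,w)=d(u,w)$, $d(v,x)+d(x,w)=d(v,w)$. Partial order on $B^n$: $a_1\cdots a_n\le b_1\cdots b_n$ iff $a_i\le b_i$ for all $i$. For $X\subseteq B^n$, the daisy cube generated by $X$ is the subgraph of $Q_n$ induced by $\{v\in B^n: v\le x \text{ for some } x\in X\}$. Djoković–Winkler relation $\Theta$ on edges of a connected graph: $uv\,\Theta\,xy$ iff $d(u,x)+d(v,y)\ne d(u,y)+d(v,x)$;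 in a partial cube it is an equivalence relation whose classes are the $\Theta$-classes, and their number equals $\mathrm{idim}(G)$. For an edge $uv$: $W_{uv}=\{w: d(u,w)<d(v,w)\}$, $W_{vu}=\{w:d(v,w)<d(u,w)\}$, $F_{uv}=\{ab\in E(G): a\in W_{uv}, b\in W_{vu}\}$ (the $\Theta$-class of $uv$ in a partial cube), $U_{uv}$ = set of vertices of $W_{uv}$ incident with an edge of $F_{uv}$, and $U_{vu}$ analogously. The $\Theta$-class $F_{uv}$ is peripheral if $U_{uv}=W_{uv}$ or $U_{vu}=W_{vu}$. Partial cube-minors: for a partial cube $G\subseteq Q_n$ isometrically embedded, each $\Theta$-class corresponds to a coordinate $i$, and the halfspaces are the sets of vertices with $i$-th coordinate $0$, respectively $1$. A restriction is a subgraph induced by an intersection of (non-complementary) halfspaces; a contraction of a $\Theta$-class contracts all its edges. A pc-minor of $G$ is any graph obtained from $G$ by a finite sequence of restrictions and contractions (possibly $G$ itself). For a set $X$ of partial cubes, $\mathscr{F}(X)$ is the class of partial cubes having no member of $X$ as a pc-minor. *)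

(* Defs.v *)
From mathcomp Require Import all_boot.

Set Implicit Arguments.
Unset Strict Implicit.
Unset Printing Implicit Defensive.

(* The vertex set may be empty: the one-vertex graph is the simplex graph of
   the null graph. *)
Record sgraph := SGraph {
  vertex :> finType;
  adj : rel vertex;
  adj_sym : symmetric adj;
  adj_irr : irreflexive adj }.

Arguments adj {s}.

Definition isomorphic (G H : sgraph) : Prop :=
  exists h : G -> H, bijective h /\ forall x y, adj (h x) (h y) = adj x y.

Section Induced.
Variables (G : sgraph) (A : {set G}).
Let ivertex := {x : G | x \in A}.
Let iadj : rel ivertex := fun x y => adj (val x) (val y).

Fact induced_sym : symmetric iadj.
Proof. by move=> x y; rewrite /iadj adj_sym. Qed.

Fact induced_irr : irreflexive iadj.
Proof. by move=> x; rewrite /iadj adj_irr. Qed.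

Definition induced := SGraph induced_sym induced_irr.
End Induced.

Definition path_adj n : rel 'I_n := fun i j => (i.+1 == j) || (j.+1 == i).

Fact path_adj_sym n : symmetric (@path_adj n).
Proof. by move=> i j; rewrite /path_adj orbC. Qed.

Fact path_adj_irr n : irreflexive (@path_adj n).
Proof. by move=> i; rewrite /path_adj orbb eqn_leq ltnn. Qed.

Definition path_graph n := SGraph (@path_adj_sym n) (@path_adj_irr n).

Notation P4 := (path_graph 4).

Section Metric.
Variable G : sgraph.
Implicit Types u v w x y : G.

Definition deg v : nat := #|[set w | adj v w]|.

(* Least length of a walk from x to y.  Vertices in the same component are at
   distance less than #|G|; the value is #|G| if there is no walk, a case ruled
   out below by [connected]. *)
Definition dist x y : nat :=
  find (fun n => [exists p : n.-tuple G, path (@adj G) x p && (last x p == y)])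
       (iota 0 #|G|).

(* The null graph is not connected. *)
Definition connected : Prop :=
  0 < #|G| /\ forall x y, connect (@adj G) x y.

Definition between u x v : bool := dist u x + dist x v == dist u v.

Definition median_graph : Prop :=
  connected /\
  forall u v w, exists! x, [/\ between u x v, between u x w & between v x w].
End Metric.

Section Hypercube.
Variable n : nat.
Implicit Types a b : n.-tuple bool.

Definition hamming a b : nat := #|[set i | tnth a i != tnth b i]|.

Definition cube_adj : rel (n.-tuple bool) := fun a b => hamming a b == 1.

Fact cube_adj_sym : symmetric cube_adj.
Proof.
move=> a b; rewrite /cube_adj /hamming; congr (#|pred_of_set _| == 1).
by apply/setP=> i; rewrite !inE eq_sym.
Qed.

Fact cube_adj_irr : irreflexive cube_adj.
Proof.
move=> a; rewrite /cube_adj /hamming.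
suff -> : [set i | tnth a i != tnth a i] = set0 by rewrite cards0.
by apply/setP=> i; rewrite !inE eqxx.
Qed.

Definition hypercube := SGraph cube_adj_sym cube_adj_irr.

Definition string_le a b : bool := [forall i, tnth a i <= tnth b i].

Definition daisy_cube (X : {set n.-tuple bool}) : sgraph :=
  @induced hypercube [set v | [exists x in X, string_le v x]].
End Hypercube.

Definition is_daisy_cube (G : sgraph) : Prop :=
  exists n (X : {set n.-tuple bool}), isomorphic G (daisy_cube X).

Section Simplex.
Variable H : sgraph.

Definition clique (A : {set H}) : bool :=
  [forall x in A, forall y in A, (x != y) ==> adj x y].

Let simplex_vertex := {A : {set H} | clique A}.

Definition adds_vertex (A B : {set H}) : bool :=
  [exists x, (x \notin A) && (B == x |: A)].

Let simplex_adj : rel simplex_vertex :=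
  fun A B => adds_vertex (val A) (val B) || adds_vertex (val B) (val A).

Fact simplex_sym : symmetric simplex_adj.
Proof. by move=> A B; rewrite /simplex_adj orbC. Qed.

Fact simplex_irr : irreflexive simplex_adj.
Proof.
move=> A; rewrite /simplex_adj orbb; apply/negbTE/existsP=> -[x].
by case/andP=> xA /eqP eA; rewrite eA setU11 in xA.
Qed.

Definition simplex_graph := SGraph simplex_sym simplex_irr.
End Simplex.

Definition is_simplex_graph (G : sgraph) : Prop :=
  exists H : sgraph, isomorphic G (simplex_graph H).

(* For connected G such an f is injective and is an isomorphism onto the
   subgraph of Q_n induced by its image. *)
Definition isometric (G : sgraph) n (f : G -> n.-tuple bool) : Prop :=
  forall u v, dist u v = hamming (f u) (f v).

Definition isometric_in_cube (G : sgraph) (n : nat) : Prop :=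
  connected G /\ exists f : G -> n.-tuple bool, isometric f.

Definition partial_cube (G : sgraph) : Prop :=
  exists n, isometric_in_cube G n.

(* idim(G) = n *)
Definition is_idim (G : sgraph) (n : nat) : Prop :=
  isometric_in_cube G n /\ forall m, isometric_in_cube G m -> n <= m.

Section ThetaClasses.
Variable G : sgraph.
Implicit Types u v x y : G.

Definition edge_set (r : rel G) : {set {set G}} :=
  [set [set p.1; p.2] | p : G * G & adj p.1 p.2 && r p.1 p.2].

(* For u v and x y adjacent; invariant under exchanging u and v, or x and y. *)
Definition Theta u v x y : bool :=
  dist u x + dist v y != dist u y + dist v x.

Definition is_Theta_class (C : {set {set G}}) : Prop :=
  exists u v, adj u v /\ C = edge_set (Theta u v).

Definition Wset u v : {set G} := [set w | dist u w < dist v w].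

Definition Fset u v : {set {set G}} :=
  edge_set (fun a b => (a \in Wset u v) && (b \in Wset v u)).

Definition Uset u v : {set G} :=
  [set a in Wset u v | [exists E in Fset u v, a \in E]].

Definition peripheral (C : {set {set G}}) : Prop :=
  exists u v, [/\ adj u v, C = Fset u v
                & Uset u v = Wset u v \/ Uset v u = Wset v u].
End ThetaClasses.

Section Contraction.
Variables (G : sgraph) (C : {set {set G}}).

Definition contract_blocks : {set {set G}} :=
  equivalence_partition (connect (fun x y => [set x; y] \in C)) [set: G].

Let cvertex := {B : {set G} | B \in contract_blocks}.

Let cadj : rel cvertex := fun B D =>
  (B != D) && [exists x in val B, exists y in val D, adj x y].

Fact contract_sym : symmetric cadj.
Proof.
suff sub B D : cadj B D -> cadj D B by move=> B D; apply/idP/idP; apply: sub.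
case/andP=> neBD /exists_inP[x xB /exists_inP[y yD xy]].
rewrite /cadj eq_sym neBD; apply/exists_inP; exists y => //.
by apply/exists_inP; exists x; rewrite // adj_sym.
Qed.

Fact contract_irr : irreflexive cadj.
Proof. by move=> B; rewrite /cadj eqxx. Qed.

Definition contract := SGraph contract_sym contract_irr.
End Contraction.

Definition halfspace (G : sgraph) n (f : G -> n.-tuple bool)
    (h : 'I_n * bool) : {set G} :=
  [set x | tnth (f x) h.1 == h.2].

(* Each coordinate of the embedding corresponds to a Theta-class, i.e. none is
   constant.  Noncomplementary halfspaces may still be disjoint; the restriction
   is then the null graph, which is not a partial cube and has no other
   pc-minors up to isomorphism. *)
Definition is_restriction (G : sgraph) (A : {set G}) : Prop :=
  exists n (f : G -> n.-tuple bool) (J : {set 'I_n * bool}),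
    [/\ connected G /\ isometric f,
        forall i, exists x y, tnth (f x) i != tnth (f y) i,
        forall i, ~~ (((i, false) \in J) && ((i, true) \in J))
      & A = \bigcap_(h in J) halfspace f h].

Inductive pc_minor (G : sgraph) : sgraph -> Prop :=
| PcMinorRefl : pc_minor G G
| PcMinorRestrict (H : sgraph) (A : {set H}) :
    pc_minor G H -> is_restriction A -> pc_minor G (induced A)
| PcMinorContract (H : sgraph) (C : {set {set H}}) :
    pc_minor G H -> is_Theta_class C -> pc_minor G (contract C).

Definition has_pc_minor (G K : sgraph) : Prop :=
  exists H, pc_minor G H /\ isomorphic H K.

Definition pc_minor_free (X : sgraph -> Prop) (G : sgraph) : Prop :=
  partial_cube G /\ forall K, X K -> ~ has_pc_minor G K.

(* Main.v *)
(** A simplex graph is the down-set of the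
    characteristic vectors of its cliques, hence a daisy cube.  Having a cube
    embedding onto a down-set is inherited by restrictions (erase the coordinates
    that are constant on the restriction) and contractions (erase the contracted
    coordinate), and fails for P4, since a leaf of a down-set is within distance
    1 of the zero vector.  A nonperipheral class i of a median graph has on each of
    its two sides a class not crossing i; contracting all but these three classes
    gives P4.  A median graph embeds in a cube through its halfspaces W_ab; if all
    classes are peripheral, orient every coordinate towards its peripheral side:
    the image is a down-set, and its zero vertex is incident with all classes.
    Finally, if a vertex v is incident with all classes, closure under medians
    shows that the image, recentred at v, consists of the cliques of the graph
    formed by its two-element sets. *)
Require Import Defs.
From mathcomp Require Import all_boot zify.

Set Implicit Arguments.
Unset Strict Implicit.
Unset Printing Implicit Defensive.

(** * Graph distance through shortest walks *)

Section Distance.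
Variable G : sgraph.
Implicit Types x y z : G.

Lemma dist_le_path x p : path adj x p -> dist x (last x p) <= size p.
Proof.
move=> xp; rewrite /dist; set a := (fun n => _).
have [lt_p|le_p] := ltnP (size p) #|G|; last first.
  (* [find] never exceeds the length [#|G|] of the searched list, which settles walks at least that
     long. *)
  by apply: leq_trans (find_size _ _) _; rewrite size_iota.
rewrite leqNgt; apply/negP=> /(before_find 0); rewrite nth_iota // add0n.
by move/existsP; apply; exists (in_tuple p); rewrite xp eqxx.
Qed.

Hypothesis connG : connected G.

Lemma dist_pathP x y :
  exists p, [/\ path adj x p, last x p = y & size p = dist x y].
Proof.
have [_ /(_ x y) /connectP[p0 xp0 ->]] := connG.
case/shortenP: xp0 => p xp uniq_p _.
set a := (fun n => [exists q : n.-tuple G,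
  path (@adj G) x q && (last x q == last x p)]).
(* A walk without repeated vertices has fewer than [#|G|] edges, so the search succeeds. *)
have has_a : has a (iota 0 #|G|).
  apply/hasP; exists (size p).
    by rewrite mem_iota add0n -[(size p).+1]/(size (x :: p)) -(card_uniqP uniq_p) max_card.
  by apply/existsP; exists (in_tuple p); rewrite xp eqxx.
have := nth_find 0 has_a; rewrite nth_iota; last by rewrite -{2}(size_iota 0 #|G|) -has_find.
rewrite add0n => /existsP[q /andP[xq /eqP lq]].
by exists q; split=> //; rewrite size_tuple.
Qed.

Lemma distxx x : dist x x = 0.
Proof. by apply/eqP; rewrite -leqn0 (@dist_le_path x [::]). Qed.

Lemma dist_eq0 x y : dist x y = 0 -> x = y.
Proof. by have [[|z p] [_ /= <- // <-]] := dist_pathP x y. Qed.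

Lemma dist_triangle x y z : dist x z <= dist x y + dist y z.
Proof.
have [p [xp lp <-]] := dist_pathP x y; have [q [yq <- <-]] := dist_pathP y z.
rewrite -lp -last_cat -size_cat; apply: dist_le_path.
by rewrite cat_path xp lp.
Qed.

Lemma dist_sym x y : dist x y = dist y x.
Proof.
suff le_d (u v : G) : dist u v <= dist v u by apply/eqP; rewrite eqn_leq !le_d.
have [p [vp lp <-]] := dist_pathP v u; rewrite -(size_belast v) -size_rev.
have {1}<- : last u (rev (belast v p)) = v.
  by rewrite -lp; case: p {vp lp} => //= z p; rewrite rev_cons last_rcons.
apply: dist_le_path; rewrite -lp rev_path.
by under eq_path do rewrite adj_sym.
Qed.

Lemma dist_step x y : x != y -> exists2 z, adj x z & dist x y = (dist z y).+1.
Proof.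
move=> neq_xy; have [[|z p] [/= xp lp sz]] := dist_pathP x y.
  by rewrite lp eqxx in neq_xy.
case/andP: xp => xz zp; exists z => //; apply/eqP; rewrite eqn_leq -{2}sz ltnS.
have le1 : dist x z <= 1 by apply: (@dist_le_path x [:: z]); rewrite /= xz.
have le2 : dist z y <= size p by rewrite -lp dist_le_path.
rewrite {}le2 andbT; apply: leq_trans (dist_triangle x z y) _.
by rewrite -add1n leq_add2r.
Qed.

Lemma dist1E x y : (dist x y == 1) = adj x y.
Proof.
apply/idP/idP=> [/eqP d1 | xy].
  have neq : x != y by apply: contra_eqN d1 => /eqP->; rewrite distxx.
  by have [z xz] := dist_step neq; rewrite d1 => -[/esym/dist_eq0 <-].
rewrite eqn_leq (@dist_le_path x [:: y]) /= ?xy // lt0n.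
by apply: contraTneq xy => /dist_eq0 ->; rewrite adj_irr.
Qed.
End Distance.

(** * Hamming distance and the erasing of coordinates *)

Section Hamming.
Variable n : nat.
Implicit Types (a b c : n.-tuple bool) (i : 'I_n) (S : {set 'I_n}).

Lemma hamming_sum a b : hamming a b = \sum_i (tnth a i != tnth b i).
Proof. by rewrite /hamming cardsE -sum1_card big_mkcond. Qed.

Lemma hamming_triangle a b c : hamming a b <= hamming a c + hamming c b.
Proof.
rewrite !hamming_sum -big_split; apply: leq_sum => i _ /=.
by case: (tnth a i) (tnth b i) (tnth c i) => [] [] [].
Qed.

Lemma hamming_eq0 a b : (hamming a b == 0) = (a == b).
Proof.
rewrite cards_eq0; apply/eqP/eqP=> [/setP eq_ab | ->].
  by apply/eq_from_tnth=> i; apply/eqP; have := eq_ab i; rewrite !inE => /negPn.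
by apply/setP=> i; rewrite !inE eqxx.
Qed.

Lemma hamming1P a b :
  reflect (exists i, forall j, (tnth a j != tnth b j) = (j == i))
          (hamming a b == 1).
Proof.
apply: (iffP cards1P) => [] [i eq_i]; exists i.
  by move=> j; have /setP/(_ j) := eq_i; rewrite !inE.
by apply/setP=> j; rewrite !inE eq_i.
Qed.

(** The difference set [D] of [a] and [b] lies in the union of the other two, and the cardinality
    bound forces equality; so a point on a geodesic departs from [a] only where [a] and [b]
    differ. *)
Lemma hamming_between a b c i : hamming a c + hamming c b <= hamming a b ->
  tnth a i = tnth b i -> tnth c i = tnth a i.
Proof.
rewrite /hamming; set A := [set j | _]; set B := [set j | _]; set D := [set j | _].
move=> le_D ab_i.
have sub_D : D \subset A :|: B.
  apply/subsetP=> j; rewrite !inE; apply: contraR.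
  by rewrite negb_or !negbK => /andP[/eqP-> /eqP->].
have /setP/(_ i) : D = A :|: B.
  apply/eqP; rewrite eqEcard sub_D; apply: leq_trans le_D.
  by rewrite cardsU leq_subr.
by rewrite !inE ab_i eqxx /=; move/esym/norP=> [/negPn/eqP].
Qed.

(** Only the summand at [i] distinguishes the two distances; adding the opposite summand on each
    side avoids subtraction. *)
Lemma hamming_flip a b c i : (forall j, (tnth a j != tnth b j) = (j == i)) ->
  hamming a c + (tnth b i != tnth c i) = hamming b c + (tnth a i != tnth c i).
Proof.
move=> ab; rewrite !hamming_sum (bigD1 i) //= [in RHS](bigD1 i) //=.
rewrite (eq_bigr (fun j => nat_of_bool (tnth b j != tnth c j))); first by lia.
move=> j /negPf ji; congr (nat_of_bool (_ != _)).
by apply/eqP/negPn; rewrite ab ji.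
Qed.

(** Coordinates outside [S] are set to [false] instead of being removed, so that all minors stay in
    one cube and erasures compose by intersection. *)
Definition mask S a : n.-tuple bool := [tuple tnth a i && (i \in S) | i < n].

Lemma tnth_mask S a i : tnth (mask S a) i = tnth a i && (i \in S).
Proof. exact: tnth_mktuple. Qed.

Lemma mask_mask S T a : mask S (mask T a) = mask (T :&: S) a.
Proof. by apply/eq_from_tnth=> i; rewrite !tnth_mask inE andbA. Qed.

Lemma hamming_mask S a b :
  hamming (mask S a) (mask S b) = \sum_(i in S) (tnth a i != tnth b i).
Proof.
rewrite hamming_sum big_mkcond [RHS]big_mkcond; apply: eq_bigr => i _.
by rewrite !tnth_mask; case: (i \in S); rewrite ?andbT ?andbF.
Qed.

Lemma hamming_maskC1 i a b : hamming a b =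
  (tnth a i != tnth b i) + hamming (mask [set~ i] a) (mask [set~ i] b).
Proof.
rewrite hamming_mask hamming_sum (bigD1 i) //; congr (_ + _).
by apply: eq_bigl => j; rewrite !inE.
Qed.
End Hamming.

(** * Isometric embeddings in hypercubes *)

(** A local form of isometry that does not mention [dist] and is therefore easy to check on minors;
    for connected graphs it is equivalent to [isometric]. *)
Definition cube_embedding (G : sgraph) n (f : G -> n.-tuple bool) : Prop :=
  (forall x y, adj x y -> hamming (f x) (f y) = 1) /\
  (forall x y, x != y ->
     exists2 z, adj x z & hamming (f z) (f y) < hamming (f x) (f y)).

Lemma isometric_cube_embedding (G : sgraph) n (f : G -> n.-tuple bool) :
  connected G -> isometric f -> cube_embedding f.
Proof.
move=> connG isof; split=> [x y | x y neq].
  by rewrite -isof -(dist1E connG) => /eqP.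
by have [z xz d] := dist_step connG neq; exists z; rewrite // -!isof d.
Qed.

Section CubeEmbedding.
Variables (G : sgraph) (n : nat) (f : G -> n.-tuple bool).
Hypothesis embf : cube_embedding f.
Implicit Types x y z : G.

Lemma embedding_inj : injective f.
Proof.
move=> x y eq_f; apply/eqP; apply/negPn/negP=> neq.
have [z _] := embf.2 _ _ neq; rewrite eq_f.
by have /eqP-> : hamming (f y) (f y) == 0 by rewrite hamming_eq0.
Qed.

Lemma embedding_adj x y : adj x y = (hamming (f x) (f y) == 1).
Proof.
apply/idP/eqP=> [|d1]; first exact: embf.1.
have neq : x != y.
  apply/eqP=> eq_xy; move: d1; rewrite eq_xy.
  by have /eqP-> : hamming (f y) (f y) == 0 by rewrite hamming_eq0.
have [z xz] := embf.2 _ _ neq.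
by rewrite d1 ltnS leqn0 hamming_eq0 => /eqP/embedding_inj <-.
Qed.

Lemma embedding_path x y :
  exists p, [/\ path adj x p, last x p = y & size p <= hamming (f x) (f y)].
Proof.
move: {2}(hamming _ _) (leqnn (hamming (f x) (f y))) => m.
elim: m x => [|m IHm] x le_m.
  exists [::]; split=> //=; apply: embedding_inj; apply/eqP.
  by rewrite -hamming_eq0 -leqn0.
have [->|neq] := eqVneq x y; first by exists [::].
have [z xz lt_z] := embf.2 _ _ neq.
have [|p [zp lp sz]] := IHm z; first by rewrite -ltnS; apply: leq_trans le_m.
by exists (z :: p); split=> //=; [rewrite xz | apply: leq_ltn_trans lt_z].
Qed.

Lemma embedding_connected : 0 < #|G| -> connected G.
Proof.
move=> G0; split=> // x y; have [p [xp <- _]] := embedding_path x y.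
by apply/connectP; exists p.
Qed.

(** Greedy descent gives a walk no longer than the Hamming distance; conversely, each edge of a walk
    changes only one coordinate. *)
Lemma embedding_isometric : connected G -> isometric f.
Proof.
move=> connG x y; apply/eqP; rewrite eqn_leq; apply/andP; split.
  by have [p [xp <- sz]] := embedding_path x y; apply: leq_trans sz; apply: dist_le_path.
have [p [xp <- <-]] := dist_pathP connG x y.
elim: p x xp => [|z p IHp] x /=.
  by have /eqP-> : hamming (f x) (f x) == 0 by rewrite hamming_eq0.
case/andP=> /embf.1 xz /IHp le_p.
by apply: leq_trans (hamming_triangle _ _ (f z)) _; rewrite xz add1n ltnS.
Qed.

Lemma edge_coord x y : adj x y ->
  exists i, forall j, (tnth (f x) j != tnth (f y) j) = (j == i).
Proof. by rewrite embedding_adj => /hamming1P. Qed.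

Lemma embedding_step x y : x != y -> exists z i,
  [/\ adj x z, forall j, (tnth (f x) j != tnth (f z) j) = (j == i),
      tnth (f x) i != tnth (f y) i & hamming (f z) (f y) < hamming (f x) (f y)].
Proof.
move=> neq; have [z xz lt_z] := embf.2 _ _ neq; have [i xz_i] := edge_coord xz.
exists z, i; split=> //; apply: contraL lt_z => /eqP xy_i; rewrite -leqNgt.
by have := hamming_flip (f y) xz_i; rewrite xy_i eqxx addn0 => <-; rewrite leq_addr.
Qed.

(** On a walk from [x] to [y] take the first edge that changes coordinate [i]. *)
Lemma coord_separating_edge i x y : tnth (f x) i != tnth (f y) i ->
  exists u v, [/\ adj u v, tnth (f u) i = tnth (f x) i
                & forall j, (tnth (f u) j != tnth (f v) j) = (j == i)].
Proof.
have [p [xp <- _]] := embedding_path x y; elim: p x xp => [|z p IHp] x /=.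
  by rewrite eqxx.
case/andP=> xz zp xl; have [j xz_j] := edge_coord xz.
have [eq_ij | neq_ij] := eqVneq i j.
  by exists x, z; split=> // k; rewrite xz_j eq_ij.
have /eqP eq_i : tnth (f x) i == tnth (f z) i.
  by rewrite -[_ == _]negbK xz_j (negPf neq_ij).
by rewrite eq_i; apply: IHp; rewrite // -eq_i.
Qed.
End CubeEmbedding.

(** * Theta-classes, contractions and restrictions in coordinates *)

Section Theta.
Variable G : sgraph.
Implicit Types u v x y : G.

Lemma in_edge_set (r : rel G) x y :
  ([set x; y] \in edge_set r) = adj x y && (r x y || r y x).
Proof.
apply/imsetP/idP=> [[[a b]] | /andP[xy /orP[r_xy|r_yx]]].
- rewrite inE /= => /andP[ab r_ab] eq_xy.
  have : x \in [set a; b] by rewrite -eq_xy set21.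
  have : y \in [set a; b] by rewrite -eq_xy set22.
  have : a \in [set x; y] by rewrite eq_xy set21.
  have : b \in [set x; y] by rewrite eq_xy set22.
  have neq_ab : a != b by apply: contraTneq ab => ->; rewrite adj_irr.
  rewrite !inE => /orP[]/eqP eb /orP[]/eqP ea _ _.
  + by rewrite ea eb eqxx in neq_ab.
  + by rewrite -ea -eb adj_sym ab r_ab orbT.
  + by rewrite -ea -eb ab r_ab.
  + by rewrite ea eb eqxx in neq_ab.
- by exists (x, y); rewrite // inE /= xy.
- by exists (y, x); [rewrite inE /= adj_sym xy | rewrite setUC].
Qed.

Variables (n : nat) (f : G -> n.-tuple bool).
Hypotheses (connG : connected G) (embf : cube_embedding f).

Lemma dist_edge_coord u v w i :
  (forall j, (tnth (f u) j != tnth (f v) j) = (j == i)) ->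
  dist u w + (tnth (f v) i != tnth (f w) i) =
  dist v w + (tnth (f u) i != tnth (f w) i).
Proof. by move=> uv; rewrite !(embedding_isometric embf) // (hamming_flip _ uv). Qed.

(** By [dist_edge_coord], the distances to [u] and [v] differ by one, with a sign given by the side
    of [i]; the signs for [x] and [y] cancel exactly if both lie on one side. *)
Lemma Theta_coord u v x y i :
  (forall j, (tnth (f u) j != tnth (f v) j) = (j == i)) ->
  Theta u v x y = (tnth (f x) i != tnth (f y) i).
Proof.
move=> uv; have := dist_edge_coord x uv; have := dist_edge_coord y uv.
have := uv i; rewrite eqxx /Theta.
move: (tnth (f u) i) (tnth (f v) i) (tnth (f x) i) (tnth (f y) i).
by move=> [] [] [] [] //=; lia.
Qed.

Lemma Wset_coord u v w i :
  (forall j, (tnth (f u) j != tnth (f v) j) = (j == i)) ->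
  (w \in Wset u v) = (tnth (f w) i == tnth (f u) i).
Proof.
move=> uv; have := dist_edge_coord w uv.
have := uv i; rewrite eqxx inE.
move: (tnth (f u) i) (tnth (f v) i) (tnth (f w) i).
by move=> [] [] [] //=; lia.
Qed.

Lemma in_Theta_class u v x y i :
  (forall j, (tnth (f u) j != tnth (f v) j) = (j == i)) ->
  ([set x; y] \in edge_set (Theta u v)) =
  adj x y && (tnth (f x) i != tnth (f y) i).
Proof.
by move=> uv; rewrite in_edge_set !(Theta_coord _ _ uv) [in X in _ || X]eq_sym orbb.
Qed.

Lemma in_Fset u v x y i : 
  (forall j, (tnth (f u) j != tnth (f v) j) = (j == i)) ->
  ([set x; y] \in Fset u v) = adj x y && (tnth (f x) i != tnth (f y) i).
Proof.
move=> uv.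
have vu j : (tnth (f v) j != tnth (f u) j) = (j == i) by rewrite eq_sym.
rewrite in_edge_set !(Wset_coord _ uv) !(Wset_coord _ vu).
have := uv i; rewrite eqxx.
by case: (tnth (f u) i) (tnth (f v) i) (tnth (f x) i) (tnth (f y) i) => [] [] [] [].
Qed.

Lemma in_Uset u v x i :
  (forall j, (tnth (f u) j != tnth (f v) j) = (j == i)) ->
  (x \in Uset u v) = (tnth (f x) i == tnth (f u) i) &&
    [exists y, adj x y && (tnth (f x) i != tnth (f y) i)].
Proof.
move=> uv; rewrite inE (Wset_coord _ uv); congr (_ && _).
apply/exists_inP/existsP=> [[E FE xE] | [y xy]]; last first.
  by exists [set x; y]; rewrite ?set21 // (in_Fset _ _ uv).
have /imsetP[[a b] _ /= eqE] := FE; move: FE xE; rewrite eqE.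
rewrite (in_Fset _ _ uv) !inE => ab /orP[]/eqP->; first by exists b.
by exists a; rewrite adj_sym eq_sym.
Qed.

Lemma Theta_class_coord u v i :
  (forall j, (tnth (f u) j != tnth (f v) j) = (j == i)) ->
  edge_set (Theta u v) = Fset u v.
Proof.
move=> uv; apply/setP=> E; apply/idP/idP=> EC.
  have /imsetP[[a b] _ /= eqE] := EC.
  by move: EC; rewrite eqE (in_Theta_class _ _ uv) (in_Fset _ _ uv).
have /imsetP[[a b] _ /= eqE] := EC.
by move: EC; rewrite eqE (in_Theta_class _ _ uv) (in_Fset _ _ uv).
Qed.

(** The contracted blocks are the fibres of [f] with coordinate [i] erased. The last two clauses
    determine the image of [g], which is what later inductions use. *)
Lemma contract_embedding u v i :
  (forall j, (tnth (f u) j != tnth (f v) j) = (j == i)) ->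
  exists g : contract (edge_set (Theta u v)) -> n.-tuple bool,
    [/\ cube_embedding g,
        forall x, exists B, g B = mask [set~ i] (f x)
      & forall B, exists x, g B = mask [set~ i] (f x)].
Proof.
move=> uv; set C := edge_set _; set e := (fun x y => [set x; y] \in C).
have eE x y : e x y = adj x y && (tnth (f x) i != tnth (f y) i).
  by rewrite /e (in_Theta_class _ _ uv).
have e_sym : connect_sym e by apply: sym_connect_sym => x y; rewrite /e setUC.
(* Vertices with equal masked images are equal or joined by a single edge of the class. *)
have maskP x y : (mask [set~ i] (f x) == mask [set~ i] (f y)) = connect e x y.
  have split_xy := hamming_maskC1 i (f x) (f y).
  apply/idP/connectP=> [eq_m | [p ep ->]].
    move: split_xy; rewrite (eqP eq_m).
    have /eqP-> : hamming (mask [set~ i] (f y)) (mask [set~ i] (f y)) == 0.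
      by rewrite hamming_eq0.
    rewrite addn0; have [eq_i d0 | neq_i d1] := eqVneq (tnth (f x) i) _.
      exists [::] => //=; apply: (embedding_inj embf); apply/esym/eqP.
      by rewrite -hamming_eq0 d0.
    by exists [:: y]; rewrite //= eE neq_i (embedding_adj embf) d1.
  elim: p x ep {split_xy} => //= z p IHp x /andP[+ /IHp/eqP <-].
  rewrite eE => /andP[/(embf.1)]; rewrite (hamming_maskC1 i) => + d1.
  by rewrite d1 add1n => -[]/eqP; rewrite hamming_eq0.
have equiv_e : {in [set: G] & &, equivalence_rel (connect e)}.
  apply: in3W; apply/equivalence_relP; split=> [x|x y z xy].
    exact: connect0.
  exact: (same_connect e_sym).
have partC := equivalence_partitionP equiv_e.
have pblockE x y : (y \in pblock (contract_blocks C) x) = connect e x y.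
  by rewrite (pblock_equivalence_partition equiv_e) ?inE.
have mem_blk x : pblock (contract_blocks C) x \in contract_blocks C.
  by rewrite pblock_mem // (cover_partition partC) inE.
pose blk x : contract C := exist (fun B => B \in contract_blocks C) _ (mem_blk x).
have blk_surj (B : contract C) : exists x, B = blk x.
  case: B => B PB.
  have [trivC n0] : trivIset (contract_blocks C) /\ set0 \notin contract_blocks C.
    by have /and3P[_ ? ?] := partC.
  have /set0Pn[x xB] : B != set0 by apply: contraNneq n0 => <-.
  by exists x; apply: val_inj; rewrite /= (def_pblock trivC PB xB).
have [r rK] := fin_all_exists blk_surj.
have blk_eq x y : (blk x == blk y) = connect e x y.
  apply/eqP/idP=> [/(congr1 val)/= eq_b | xy].
    by rewrite -pblockE eq_b pblockE connect0.
  apply: val_inj => /=; apply/setP=> z; rewrite !pblockE.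
  exact: same_connect.
have mem_blkE x y : (y \in val (blk x)) = connect e x y by rewrite pblockE.
pose g B := mask [set~ i] (f (r B)).
have g_blk x : g (blk x) = mask [set~ i] (f x).
  by apply/eqP; rewrite maskP -blk_eq -rK.
have g_adj x y : adj x y -> mask [set~ i] (f x) != mask [set~ i] (f y) ->
    adj (blk x) (blk y).
  move=> xy neq; apply/andP; split; first by rewrite blk_eq -maskP.
  apply/exists_inP; exists x; first by rewrite mem_blkE connect0.
  by apply/exists_inP; exists y; rewrite ?mem_blkE ?connect0.
exists g; split; last 2 first.
- by move=> x; exists (blk x).
- by move=> B; exists (r B).
split=> B D.
  rewrite {1}(rK B) {1}(rK D) => /andP[neq /exists_inP[x xB /exists_inP[y yD xy]]].
  move: xB yD neq; rewrite !mem_blkE blk_eq -!maskP /g => /eqP-> /eqP->.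
  rewrite -hamming_eq0; have := embf.1 _ _ xy; rewrite (hamming_maskC1 i).
  by lia.
rewrite (rK B) (rK D) blk_eq -maskP !g_blk; move: (r B) (r D) => {B D} x y neq.
(* An edge outside the class that starts in the block of [x] and approaches [y] suffices: coordinate
   [i] is constant on it, so the decrease survives the erasure. *)
suff [x1 [x2 [eq1 adj12 eq_i lt12]]] : exists x1 x2, [/\
    mask [set~ i] (f x1) = mask [set~ i] (f x), adj x1 x2,
    tnth (f x1) i = tnth (f x2) i &
    hamming (f x2) (f y) < hamming (f x1) (f y)].
  rewrite !(hamming_maskC1 i _ (f y)) eq_i ltn_add2l in lt12.
  exists (blk x2); last by rewrite g_blk -eq1.
  have /eqP -> : blk x == blk x1 by rewrite blk_eq -maskP eq1.
  by apply: g_adj => //; apply: contraTneq lt12 => ->; rewrite ltnn.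
have neq_xy : x != y by apply: contraNneq neq => ->.
have [z [j [xz xz_j xy_j lt_z]]] := embedding_step embf neq_xy.
have [eq_ji | neq_ji] := eqVneq i j; last first.
  by exists x, z; split=> //; apply/eqP; rewrite -[_ == _]negbK xz_j.
(* The first step towards [y] crosses [i] and thus stays in the block of [x]. Since [z] and [y] now
   agree at [i], the next step leaves [i] unchanged. *)
subst j.
have eq_m : mask [set~ i] (f z) = mask [set~ i] (f x).
  apply/esym/eqP; rewrite -hamming_eq0; have := embf.1 _ _ xz.
  by rewrite (hamming_maskC1 i) xz_j eqxx; lia.
have neq_zy : z != y by apply: contraNneq neq => <-; rewrite eq_m.
have [w [k [zw zw_k zy_k lt_w]]] := embedding_step embf neq_zy.
exists z, w; split=> //; apply/eqP; rewrite -[_ == _]negbK zw_k.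
apply: contraNneq zy_k => <-; move: xy_j (xz_j i); rewrite eqxx.
by case: (tnth (f x) i) (tnth (f y) i) (tnth (f z) i) => [] [] [].
Qed.

(** The embedding [h] that defines the restriction may differ from [f], but each of its halfspaces
    is a set [Wset u v], which depends on distances only and so is a halfspace of [f]. Hence [A] is
    cut out by the coordinates of [f] that are constant on it, and these can be erased. *)
Lemma restriction_embedding (A : {set G}) w :
  is_restriction A -> w \in A ->
  exists S : {set 'I_n},
    [/\ forall x, x \in A <-> forall i, i \in S -> tnth (f x) i = tnth (f w) i
      & cube_embedding (fun x : induced A => mask (~: S) (f (val x)))].
Proof.
case=> m [h [J [[_ isoh] h_ncst J_ncpl defA]]] wA.
have embh := isometric_cube_embedding connG isoh.
pose S := [set i | [forall x in A, tnth (f x) i == tnth (f w) i]].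
have inA x :
  reflect (forall i, i \in S -> tnth (f x) i = tnth (f w) i) (x \in A).
  apply: (iffP idP) => [xA i | xS].
    by rewrite inE => /forall_inP/(_ _ xA)/eqP.
  rewrite defA; apply/bigcapP=> -[k b] Jk; rewrite inE /=.
  have A_k y : y \in A -> tnth (h y) k = b.
    by rewrite defA => /bigcapP/(_ _ Jk); rewrite inE => /eqP.
  have [p [q neq_k]] := h_ncst k.
  have [u [v [uv _ uv_h]]] := coord_separating_edge embh neq_k.
  have [i uv_f] := edge_coord embf uv.
  (* Both sides say that [y] is closer to [u] than to [v]. *)
  have side y : (tnth (h y) k == tnth (h u) k) = (tnth (f y) i == tnth (f u) i).
    rewrite -(Wset_coord _ uv_f) !inE !isoh.
    have := hamming_flip (h y) uv_h; have := uv_h k; rewrite eqxx.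
    by move: (tnth (h u) k) (tnth (h v) k) (tnth (h y) k) => [] [] [] //=; lia.
  have eq_i : tnth (f x) i = tnth (f w) i.
    apply: xS; rewrite inE; apply/forall_inP=> y yA.
    have := side y; have := side w; rewrite (A_k y yA) (A_k w wA).
    by case: (_ == _) (tnth (f y) i) (tnth (f w) i) (tnth (f u) i) => [] [] [] [].
  have := side x; have := side w; rewrite (A_k w wA) eq_i => <-.
  by case: b (tnth (h x) k) (tnth (h u) k) {Jk A_k} => [] [] [].
exists S; split=> [x|]; first exact: iff_sym (rwP (inA x)).
have hamm x y : x \in A -> y \in A ->
    hamming (mask (~: S) (f x)) (mask (~: S) (f y)) = hamming (f x) (f y).
  move=> /inA xS /inA yS; rewrite hamming_mask hamming_sum big_mkcond.
  by apply: eq_bigr => i _; rewrite inE; case: ifPn => // /negPn iS; rewrite xS ?yS ?eqxx.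
split=> [x y xy | x y neq]; first by rewrite hamm ?(valP x) ?(valP y) // embf.1.
have neq_xy : val x != val y by [].
have [z [i [xz xz_i xy_i lt_z]]] := embedding_step embf neq_xy.
(* The step flips a coordinate in which two members of [A] differ, hence none in [S]. *)
have zA : z \in A.
  apply/inA=> j jS; have /inA/(_ _ jS) <- := valP x; apply/esym/eqP.
  rewrite -[_ == _]negbK xz_i; apply: contraNneq xy_i => <-.
  by have /inA-> // := valP x; have /inA-> // := valP y.
by exists (exist (fun x => x \in A) z zA); rewrite // !hamm ?(valP x) ?(valP y).
Qed.
End Theta.

(** * Down-sets in the hypercube, daisy cubes and simplex graphs *)

Lemma inj_surj_bij (T U : finType) (h : T -> U) :
  injective h -> (forall u, exists t, h t = u) -> bijective h.
Proof.
by move=> inj_h /fin_all_exists[g gK]; exists g => // t; apply: inj_h; rewrite gK.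
Qed.

(** Serves to get downward closure of a vertex encoding [D] from single deletions. *)
Lemma delete_closed_subset (T : Type) (I : finType) (D : T -> {set I}) :
    (forall x i, i \in D x -> exists y, D y = D x :\ i) ->
  forall x (S : {set I}), S \subset D x -> exists y, D y = S.
Proof.
move=> D_del x S; move: {2}#|D x :\: S| (leqnn #|D x :\: S|) => m.
elim: m x => [|m IHm] x le_m sub_S.
  exists x; apply/eqP; rewrite eqEsubset sub_S andbT -setD_eq0 -cards_eq0.
  by rewrite -leqn0.
have [D0|[i]] := set_0Vmem (D x :\: S); first by apply: IHm sub_S; rewrite D0 cards0.
rewrite in_setD => /andP[iS ix]; have [y Dy] := D_del x i ix.
apply: (IHm y); last by rewrite Dy subsetD1 sub_S.
rewrite -ltnS; apply: leq_trans le_m; apply: proper_card; rewrite Dy.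
apply/properP; split; first by rewrite setSD // subD1set.
by exists i; rewrite !in_setD ?in_set1 ?eqxx ?iS.
Qed.

Definition downset (T : Type) n (f : T -> n.-tuple bool) : Prop :=
  forall x a, string_le a (f x) -> exists y, f y = a.

Section Flip.
Variable n : nat.
Implicit Types (a b : n.-tuple bool) (i : 'I_n).

Definition flip i a : n.-tuple bool := [tuple tnth a j (+) (j == i) | j < n].

Lemma tnth_flip i a j : tnth (flip i a) j = tnth a j (+) (j == i).
Proof. exact: tnth_mktuple. Qed.

Lemma flip_coord i a j : (tnth a j != tnth (flip i a) j) = (j == i).
Proof. by rewrite tnth_flip; case: (tnth a j) (j == i) => [] []. Qed.

Lemma hamming_flip1 i a : hamming a (flip i a) = 1.
Proof. by apply/eqP/hamming1P; exists i => j; apply: flip_coord. Qed.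

Lemma hamming_flip_lt i a b :
  tnth a i != tnth b i -> hamming (flip i a) b < hamming a b.
Proof.
move=> ab; have := hamming_flip b (flip_coord i a); rewrite tnth_flip eqxx.
by case: (tnth a i) (tnth b i) ab => [] [] //=; lia.
Qed.

Lemma flip_le i a : tnth a i -> string_le (flip i a) a.
Proof.
move=> ai; apply/forallP=> j; rewrite tnth_flip.
by case: eqVneq => [->|_]; rewrite ?ai //= addbF.
Qed.
End Flip.

(** If [f x] has a one that [f y] lacks, deleting it stays in the down-set. Otherwise [f x] lies
    below [f y], and adding a missing one gives a string still below [f y]. *)
Lemma downset_embedding (G : sgraph) n (f : G -> n.-tuple bool) :
    injective f -> (forall x y, adj x y = (hamming (f x) (f y) == 1)) ->
  downset f -> cube_embedding f.
Proof.
move=> inj_f f_adj down; split=> [x y | x y neq]; first by rewrite f_adj => /eqP.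
have step i z : f z = flip i (f x) -> tnth (f x) i != tnth (f y) i ->
    exists2 z, adj x z & hamming (f z) (f y) < hamming (f x) (f y).
  move=> fz xy_i; exists z; first by rewrite f_adj fz hamming_flip1.
  by rewrite fz hamming_flip_lt.
have [/existsP[i /andP[xi yi]] | /existsPn le_xy] :=
    boolP [exists i, tnth (f x) i && ~~ tnth (f y) i].
  have [z fz] := down _ _ (flip_le xi).
  by apply: (step i z fz); rewrite xi; case: (tnth _ _) yi.
have [|[i]] := set_0Vmem [set i | tnth (f x) i != tnth (f y) i].
  move/eqP; rewrite -cards_eq0 -/(hamming _ _) hamming_eq0.
  by move/eqP/inj_f => eq_xy; rewrite eq_xy eqxx in neq.
rewrite inE => xy_i; have [|z fz] := down y (flip i (f x)); last exact: step fz xy_i.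
apply/forallP=> j; rewrite tnth_flip; have := le_xy j.
case: eqVneq => [->|_]; first by case: (tnth (f x) i) (tnth (f y) i) xy_i => [] [].
by case: (tnth (f x) j) (tnth (f y) j) => [] [].
Qed.

(** The whole image of [f] serves as generating set. *)
Lemma downset_daisy_cube (G : sgraph) n (f : G -> n.-tuple bool) :
    injective f -> (forall x y, adj x y = (hamming (f x) (f y) == 1)) ->
  downset f -> is_daisy_cube G.
Proof.
move=> inj_f f_adj down; exists n, [set f x | x : G].
pose D := [set v | [exists x in [set f x | x : G], string_le v x]].
have fD x : f x \in D.
  rewrite inE; apply/exists_inP; exists (f x); first exact: imset_f.
  by apply/forallP.
pose h x : daisy_cube [set f x | x : G] := exist (fun v => v \in D) (f x) (fD x).
exists h; split=> [|x y]; last by rewrite f_adj.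
apply: inj_surj_bij => [x y /(congr1 val)/inj_f // | [v vD]].
have := vD; rewrite inE => /exists_inP[_ /imsetP[x _ ->] /down[y fy]].
by exists y; apply: val_inj.
Qed.

Lemma daisy_cube_embedding (G : sgraph) : is_daisy_cube G ->
  exists n (f : G -> n.-tuple bool), cube_embedding f /\ downset f.
Proof.
case=> n [X [h [[g hK gK] h_adj]]]; exists n, (fun x => val (h x)).
have down : downset (fun x => val (h x)).
  move=> x a le_a.
  set D : {set n.-tuple bool} := [set v | [exists x in X, string_le v x]].
  have aD : a \in D.
    have := valP (h x); rewrite !inE => /exists_inP[b bX le_b].
    apply/exists_inP; exists b => //; apply/forallP=> i.
    by apply: leq_trans (forallP le_a i) (forallP le_b i).
  by exists (g (exist (fun v => v \in D) a aD)); rewrite gK.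
split=> //; apply: downset_embedding => // [x y /val_inj/(can_inj hK) // | x y].
by rewrite -h_adj.
Qed.

(** Turns adjacency of cliques into Hamming distance one of characteristic vectors. *)
Lemma adds_vertexE (H : sgraph) (A B : {set H}) :
  adds_vertex A B || adds_vertex B A = (#|[set z | (z \in A) != (z \in B)]| == 1).
Proof.
apply/idP/idP.
  by case/orP=> /existsP[z /andP[zA /eqP eqB]]; apply/cards1P; exists z;
    apply/setP=> t; rewrite eqB !inE; case: (eqVneq t z) => [->|_] //=;
    rewrite ?(negPf zA) ?eqxx.
case/cards1P=> z /setP eqz; have := eqz z; rewrite !inE eqxx => z_neq.
have [zA|zA] := boolP (z \in A); apply/orP; [right|left]; apply/existsP; exists z.
  move: z_neq; rewrite zA; case: (boolP (z \in B)) => // zB _ /=.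
  apply/eqP/setP=> t; have := eqz t; rewrite !inE.
  case: (eqVneq t z) => [->|_] /=; first by rewrite zA.
  by case: (t \in A) (t \in B) => [] [].
move: z_neq; rewrite (negPf zA) /=; case: (boolP (z \in B)) => // zB _ /=.
apply/eqP/setP=> t; have := eqz t; rewrite !inE.
case: (eqVneq t z) => [->|_] /=; first by rewrite zB.
by case: (t \in A) (t \in B) => [] [].
Qed.

Lemma simplex_graph_daisy_cube (G : sgraph) :
  is_simplex_graph G -> is_daisy_cube G.
Proof.
case=> H [h [[g hK gK] h_adj]].
pose f x : #|H|.-tuple bool := [tuple enum_val i \in val (h x) | i < #|H|].
have f_in x z : tnth (f x) (enum_rank z) = (z \in val (h x)).
  by rewrite tnth_mktuple enum_rankK.
have hamm x y : hamming (f x) (f y) =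
    #|[set z | (z \in val (h x)) != (z \in val (h y))]|.
  rewrite /hamming -(card_imset _ (@enum_val_inj H predT)).
  apply: eq_card => z; rewrite inE; apply/imsetP/idP=> [[i] | neq_z].
    by rewrite inE !tnth_mktuple => neq ->.
  by exists (enum_rank z); rewrite ?enum_rankK // inE !f_in.
apply: (@downset_daisy_cube _ _ f) => [x y eq_f | x y | x a le_a].
- apply: (can_inj hK); apply: val_inj; apply/setP=> z.
  by rewrite -!f_in eq_f.
- by rewrite -h_adj hamm -adds_vertexE.
- pose A := [set z | tnth a (enum_rank z)].
  have A_cl : clique A.
    have sub_A z : z \in A -> z \in val (h x).
      by rewrite inE -f_in => az; have := forallP le_a (enum_rank z); rewrite az; case: (tnth _ _).
    apply/forall_inP=> z /sub_A zx; apply/forall_inP=> t /sub_A tx.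
    by have /forall_inP/(_ z zx)/forall_inP/(_ t tx) := valP (h x).
  exists (g (exist (fun A => clique A) A A_cl)); apply/eq_from_tnth=> i.
  by rewrite tnth_mktuple gK inE enum_valK.
Qed.

(** * Minors of down-sets and the exclusion of [P4] *)

Lemma mask_le n S (a : n.-tuple bool) : string_le (mask S a) a.
Proof. by apply/forallP=> i; rewrite tnth_mask; case: (tnth a i) (i \in S) => [] []. Qed.

Lemma pc_minor_downset (G H : sgraph) n (f : G -> n.-tuple bool) :
    pc_minor G H -> cube_embedding f -> downset f ->
  exists g : H -> n.-tuple bool, cube_embedding g /\ downset g.
Proof.
move=> GH embf downf.
elim: GH => [|K A _ [g [embg downg]] resA|K C _ [g [embg downg]] [u [v [uv ->]]]].
- by exists f.
- have connK : connected K by case: resA => m [h [J [[]]]].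
  have [A0|[w wA]] := set_0Vmem A.
    have noA (x : induced A) : False by have /setP/(_ (val x)) := A0; rewrite (valP x) inE.
    by exists (fun x => g (val x)); split=> [|x]; [split=> x | ]; case: (noA x).
  have [S [inA embA]] := restriction_embedding connK embg resA wA.
  exists (fun x => mask (~: S) (g (val x))); split=> // x a le_a.
  have a_S i : i \in S -> tnth a i = false.
    move=> iS; have := forallP le_a i; rewrite tnth_mask inE iS andbF.
    by case: (tnth a i).
  (* Refilling the erased coordinates with their constant values on [A] gives a string below
     [g (val x)] whose preimage lies in [A]. *)
  pose b := [tuple if i \in S then tnth (g (val x)) i else tnth a i | i < n].
  have [|y gy] := downg (val x) b.
    apply/forallP=> i; rewrite tnth_mktuple; case: ifP => // _.
    by have := forallP le_a i; rewrite tnth_mask; case: (tnth a i) (tnth (g _) i) => [] [].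
  have yA : y \in A.
    apply/inA=> i iS; rewrite gy tnth_mktuple iS.
    by have /inA/(_ i iS) := valP x.
  exists (exist (fun y => y \in A) y yA); apply/eq_from_tnth=> i.
  rewrite tnth_mask /= gy tnth_mktuple inE.
  by case: ifPn => [/a_S-> | _]; rewrite ?andbF ?andbT.
- have connK : connected K by apply: (embedding_connected embg); apply/card_gt0P; exists u.
  have [i uv_i] := edge_coord embg uv.
  have [h [embh h_surj h_im]] := contract_embedding connK embg uv_i.
  exists h; split=> // B a; have [x ->] := h_im B => le_a.
  (* The string [a] lies below [g x] itself, and is zero at [i], so the final erasure leaves it
     unchanged. *)
  have [|y gy] := downg x a.
    by apply/forallP=> j; apply: leq_trans (forallP le_a j) (forallP (mask_le _ _) j).
  have [D hD] := h_surj y; exists D; rewrite hD gy.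
  apply/eq_from_tnth=> j; rewrite tnth_mask; have := forallP le_a j.
  by rewrite tnth_mask; case: (tnth a j) (j \in _) => [] []; rewrite ?andbF.
Qed.

Lemma P4_not_downset (H : sgraph) n (f : H -> n.-tuple bool) :
  isomorphic H P4 -> cube_embedding f -> ~ downset f.
Proof.
case=> h [[g hK gK] h_adj] embf down.
have z_ex : exists z, forall i, tnth (f z) i = false.
  have [z fz] := down _ _ (mask_le set0 (f (g ord0))).
  by exists z => i; rewrite fz tnth_mask inE andbF.
have [z fz] := z_ex.
(* Deleting two different ones from [f x] would produce two different neighbours, so a leaf has at
   most one nonzero coordinate. *)
have leaf_near x : (forall y t, adj x y -> adj x t -> y = t) -> x = z \/ adj x z.
  move=> leaf_x; have [/existsP[i xi]|/existsPn x0] := boolP [exists i, tnth (f x) i].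
    right; rewrite (embedding_adj embf); apply/hamming1P; exists i => j.
    rewrite fz; case: (eqVneq j i) => [->|neq]; first by rewrite xi.
    apply/negbTE; rewrite negbK eqbF_neg; apply: contra neq => xj.
    have [y fy] := down _ _ (flip_le xi); have [t ft] := down _ _ (flip_le xj).
    have eq_yt : y = t.
      by apply: leaf_x; rewrite (embedding_adj embf) ?fy ?ft hamming_flip1.
    by have := flip_coord i (f x) j; rewrite -fy eq_yt ft flip_coord eqxx => <-.
  left; apply: (embedding_inj embf); apply/eq_from_tnth=> i; rewrite fz.
  exact/negbTE/x0.
have leaf (i j : P4) : (forall k, adj i k = (k == j)) -> (h z == i) || adj i (h z).
  move=> i_j; have [y t|<-|] := leaf_near (g i).
  - rewrite -!h_adj gK !i_j => /eqP hy /eqP ht.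
    by apply: (can_inj hK); rewrite hy ht.
  - by rewrite gK eqxx.
  - by rewrite -h_adj gK => ->; rewrite orbT.
have leaf0 := leaf (@Ordinal 4 0 isT) (@Ordinal 4 1 isT).
have leaf3 := leaf (@Ordinal 4 3 isT) (@Ordinal 4 2 isT).
have: (h z == @Ordinal 4 0 isT) || adj (@Ordinal 4 0 isT : P4) (h z).
  by apply: leaf0; case=> [[|[|[|[|]]]]].
have: (h z == @Ordinal 4 3 isT) || adj (@Ordinal 4 3 isT : P4) (h z).
  by apply: leaf3; case=> [[|[|[|[|]]]]].
(* No vertex of [P4] is within distance one of both ends. *)
by case: (h z) => [[|[|[|[|]]]]].
Qed.

Lemma daisy_cube_P4_free (G : sgraph) : connected G ->
  is_daisy_cube G -> pc_minor_free (fun K => K = P4) G.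
Proof.
move=> connG /daisy_cube_embedding[n [f [embf downf]]]; split=> [|_ -> [H [GH iso_H]]].
  by exists n; split=> //; exists f; apply: embedding_isometric.
have [g [embg]] := pc_minor_downset GH embf downf.
exact: P4_not_downset iso_H embg.
Qed.

(** * Nonperipheral classes of median graphs yield [P4] *)

(** Induction on the number of coordinates outside [S]: treat [i |: S] first, then contract the
    class of [i]. *)
Lemma Theta_class_minor_mask (G : sgraph) n (f : G -> n.-tuple bool)
    (S : {set 'I_n}) : connected G -> cube_embedding f ->
  exists (K : sgraph) (g : K -> n.-tuple bool),
    [/\ pc_minor G K, cube_embedding g,
        forall x, exists y, g y = mask S (f x)
      & forall y, exists x, g y = mask S (f x)].
Proof.
move=> connG embf; move: {2}#|~: S| (leqnn #|~: S|) => m.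
elim: m S => [|m IHm] S le_m.
  have maskS a : mask S a = a.
    have ST : ~: S = set0 by apply/eqP; rewrite -cards_eq0 -leqn0.
    apply/eq_from_tnth=> i; rewrite tnth_mask.
    by have /setP/(_ i) := ST; rewrite !inE => /negbFE ->; rewrite andbT.
  exists G, f; split=> // [|x|x]; first exact: PcMinorRefl.
    by exists x; rewrite maskS.
  by exists x; rewrite maskS.
have [S0|[i]] := set_0Vmem (~: S).
  by apply: IHm; rewrite S0 cards0.
rewrite inE => iS; have eqS : (i |: S) :&: [set~ i] = S.
  apply/setP=> j; rewrite !inE.
  by case: (eqVneq j i) => [->|_]; rewrite ?(negPf iS) //= andbT.
have [|K [g [GK embg g_surj g_im]]] := IHm (i |: S).
  rewrite -ltnS; apply: leq_trans le_m; apply: proper_card.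
  rewrite properC; apply/properP; split; first exact: subsetUr.
  by exists i; rewrite // setU11.
have maskE x y : g y = mask (i |: S) (f x) -> mask [set~ i] (g y) = mask S (f x).
  by move=> ->; rewrite mask_mask eqS.
have [/existsP[y /existsP[z yz_i]] | const_i] :=
    boolP [exists y, exists z, tnth (g y) i != tnth (g z) i].
  have [u [v [uv _ uv_i]]] := coord_separating_edge embg yz_i.
  have connK : connected K by apply: (embedding_connected embg); apply/card_gt0P; exists u.
  have [h [embh h_surj h_im]] := contract_embedding connK embg uv_i.
  exists (contract (edge_set (Theta u v))), h; split=> // [|x|B].
  - by apply: PcMinorContract => //; exists u, v.
  - have [t /maskE <-] := g_surj x; exact: h_surj.
  - have [t ->] := h_im B; have [x /maskE ->] := g_im t; by exists x.
(* No edge of [K] crosses [i]; the graph is kept and erasing the constant coordinate preserves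
   distances. *)
have hamm y z : hamming (mask [set~ i] (g y)) (mask [set~ i] (g z)) = hamming (g y) (g z).
  rewrite [in RHS](hamming_maskC1 i); suff -> : tnth (g y) i = tnth (g z) i by rewrite eqxx.
  by apply/eqP; have /existsPn/(_ y)/existsPn/(_ z) := const_i; rewrite negbK.
exists K, (fun y => mask [set~ i] (g y)); split=> // [|x|y].
- split=> [y z|y z]; first by rewrite hamm; apply: embg.1.
  by move=> /embg.2[t yt lt_t]; exists t; rewrite // !hamm.
- by have [y /maskE] := g_surj x; exists y.
- by have [x /maskE] := g_im y; exists x.
Qed.

(** The formula is the coordinatewise majority, with [z] deciding where [x] and [y] disagree. Two of
    three bits always agree, and the geodesic between those two vertices fixes the bit of the
    median. *)
Lemma embedding_median (G : sgraph) n (f : G -> n.-tuple bool) x y z :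
    median_graph G -> cube_embedding f ->
  exists m, forall i, tnth (f m) i =
    if tnth (f x) i == tnth (f y) i then tnth (f x) i else tnth (f z) i.
Proof.
case=> connG med embf; have [m [[/eqP xy /eqP xz /eqP yz] _]] := med x y z.
exists m => i; move: xy xz yz; rewrite !(embedding_isometric embf) //.
move=> /eq_leq/hamming_between-/(_ i) xy.
move=> /eq_leq/hamming_between-/(_ i) xz.
move=> /eq_leq/hamming_between-/(_ i) yz.
case: eqVneq => [/xy // | neq].
case: (eqVneq (tnth (f x) i) (tnth (f z) i)) => [eq_xz | neq_xz].
  by rewrite -eq_xz xz.
have eq_yz : tnth (f y) i = tnth (f z) i.
  by case: (tnth (f x) i) (tnth (f y) i) (tnth (f z) i) neq neq_xz => [] [] [].
by rewrite -eq_yz yz.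
Qed.

(* A vertex x at least distance from p among those incident with the class i,
   on the side of p, has a neighbour x' towards p; the direction j of the edge
   x x' does not cross i, for otherwise a median would show that x' is incident
   with the class i, too. *)
Lemma noncrossing_coord (G : sgraph) n (f : G -> n.-tuple bool) i p q :
    median_graph G -> cube_embedding f ->
    tnth (f p) i != tnth (f q) i ->
    (forall y, adj p y -> tnth (f y) i = tnth (f p) i) ->
  exists j x, [/\ tnth (f x) i = tnth (f p) i, tnth (f x) j != tnth (f p) j
    & forall w, tnth (f w) i != tnth (f p) i -> tnth (f w) j = tnth (f x) j].
Proof.
move=> medG embf pq_i p_inner.
pose P x := (tnth (f x) i == tnth (f p) i) &&
  [exists y, adj x y && (tnth (f y) i != tnth (f x) i)].
have [u [v [uv up_i uv_i]]] := coord_separating_edge embf pq_i.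
have Pu : P u.
  rewrite /P up_i eqxx; apply/existsP; exists v.
  by rewrite uv -up_i eq_sym uv_i /=.
case: (arg_minnP (fun x => hamming (f x) (f p)) Pu) => x.
case/andP=> /eqP xp_i /existsP[y /andP[xy xy_i]] min_x.
have neq_xp : x != p.
  by apply: contraNneq xy_i => eq_xp; rewrite eq_xp p_inner // -eq_xp.
have [x' [j [xx' xx'_j xp_j lt_x']]] := embedding_step embf neq_xp.
exists j, x; split=> // w wp_i; apply/eqP; apply: contraT => wx_j.
have ij : i != j.
  by apply: contraNneq xp_j => <-; rewrite xp_i.
have [k xy_k] := edge_coord embf xy; have eq_ki : i = k.
  by apply/eqP; rewrite -xy_k eq_sym.
subst k.
have [m fm] := embedding_median x' y w medG embf.
suff x'm_i : forall k, (tnth (f x') k != tnth (f m) k) = (k == i).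
  suff Px' : P x' by have := min_x _ Px'; rewrite leqNgt lt_x'.
  have x'x_i : tnth (f x') i = tnth (f x) i.
    by apply/esym/eqP; rewrite -[_ == _]negbK xx'_j.
  rewrite /P x'x_i xp_i eqxx; apply/existsP; exists m.
  rewrite (embedding_adj embf) -xp_i -x'x_i
    (eq_sym (tnth (f m) i)) x'm_i eqxx andbT.
  by apply/hamming1P; exists i.
(* In the majority of [x'], [y] and [w], the last two outvote [x'] at [i], while [w] sides with [x']
   at [j]; elsewhere [x'] and [y] agree. *)
move=> k; rewrite fm; have := xx'_j k; have := xy_k k.
case: (eqVneq k i) => [->|ki].
  rewrite (negPf ij); move: wp_i; rewrite -xp_i.
  by case: (tnth (f x) i) (tnth (f x') i) (tnth (f y) i) (tnth (f w) i) => [] [] [] [].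
case: (eqVneq k j) => [->|kj].
  move: wx_j.
  by case: (tnth (f x) j) (tnth (f x') j) (tnth (f y) j) (tnth (f w) j) => [] [] [] [].
by case: (tnth (f x) k) (tnth (f x') k) (tnth (f y) k) => [] [] [].
Qed.

Lemma P4_free_peripheral (G : sgraph) : median_graph G ->
  pc_minor_free (fun K => K = P4) G ->
  forall C : {set {set G}}, is_Theta_class C -> peripheral C.
Proof.
move=> medG [[n [connG [f isof]]] noP4] C [u [v [uv ->]]].
have embf := isometric_cube_embedding connG isof.
have [i uv_i] := edge_coord embf uv.
have vu_i j : (tnth (f v) j != tnth (f u) j) = (j == i) by rewrite eq_sym.
have UsubW a b : Uset a b \subset Wset a b.
  by apply/subsetP=> x; rewrite inE => /andP[].
exists u, v; split; [by [] | exact: Theta_class_coord uv_i |].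
have [eqU|neqU] := eqVneq (Uset u v) (Wset u v); [by left | right].
apply/eqP; apply: contraT => neqU'; exfalso.
(* A side that is not peripheral contains a vertex without neighbours across [i]. *)
have inner a b : (forall j, (tnth (f a) j != tnth (f b) j) = (j == i)) ->
    Uset a b != Wset a b -> exists2 p, tnth (f p) i = tnth (f a) i &
      forall y, adj p y -> tnth (f y) i = tnth (f p) i.
  move=> ab_i neq; have /properP[_ [p pW pU]] : Uset a b \proper Wset a b.
    by rewrite properEneq neq UsubW.
  move: pW; rewrite (Wset_coord connG embf _ ab_i) => /eqP pa_i; exists p => // y py.
  apply/esym/eqP; apply: contraNT pU => py_i.
  rewrite (in_Uset connG embf _ ab_i) pa_i eqxx; apply/existsP; exists y.
  by rewrite py -pa_i.
have [p pu_i p_inner] := inner u v uv_i neqU.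
have [q qv_i q_inner] := inner v u vu_i neqU'.
have pq_i : tnth (f p) i != tnth (f q) i by rewrite pu_i qv_i uv_i.
have [j [x [xp_i xp_j cst_j]]] := noncrossing_coord medG embf pq_i p_inner.
have qp_i : tnth (f q) i != tnth (f p) i by rewrite eq_sym.
have [k [z [zq_i zq_k cst_k]]] := noncrossing_coord medG embf qp_i q_inner.
have ij : i != j by apply: contraNneq xp_j => <-; rewrite xp_i.
have ik : i != k by apply: contraNneq zq_k => <-; rewrite zq_i.
(* Coordinate [k] is constant on the side of [p], which contains [x], whereas [j] separates [x] from
   [p]. *)
have jk : j != k.
  apply: contraNneq xp_j => eq_jk; rewrite eq_jk (cst_k x) ?(cst_k p) //.
  by rewrite xp_i.
pose S := i |: (j |: [set k]).
have iS : i \in S by rewrite !inE eqxx.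
have jS : j \in S by rewrite !inE eqxx orbT.
have kS : k \in S by rewrite !inE eqxx !orbT.
have [K [g [GK embg g_surj g_im]]] := Theta_class_minor_mask S connG embf.
apply: (noP4 P4 erefl); exists K; split=> //.
have hamm y t : hamming (g y) (g t) = (tnth (g y) i != tnth (g t) i) +
    ((tnth (g y) j != tnth (g t) j) + (tnth (g y) k != tnth (g t) k)).
  have [a ga] := g_im y; have [b gb] := g_im t.
  rewrite ga gb hamming_mask !tnth_mask iS jS kS !andbT /S.
  rewrite !big_setU1 ?big_set1 ?inE //; first by rewrite negb_or ij ik.
have cst_gk y : tnth (g y) i = tnth (f p) i -> tnth (g y) k = tnth (f z) k.
  have [a ->] := g_im y; rewrite !tnth_mask iS kS !andbT => ap_i.
  by apply: cst_k; rewrite ap_i.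
have cst_gj y : tnth (g y) i != tnth (f p) i -> tnth (g y) j = tnth (f x) j.
  have [a ->] := g_im y; rewrite !tnth_mask iS jS !andbT; exact: cst_j.
have lift a : exists y, [/\ tnth (g y) i = tnth (f a) i,
    tnth (g y) j = tnth (f a) j & tnth (g y) k = tnth (f a) k].
  by have [y gy] := g_surj a; exists y; rewrite gy !tnth_mask iS jS kS !andbT.
pose o m (lt_m : m < 4) : P4 := Ordinal lt_m.
(* On the side of [p] only [j] varies, on the side of [q] only [k]. This leaves four strings, those
   of [p], [x], [z] and [q] in the order of the path. *)
pose h y : P4 :=
  if tnth (g y) i == tnth (f p) i
  then if tnth (g y) j == tnth (f x) j then o 1 isT else o 0 isT
  else if tnth (g y) k == tnth (f z) k then o 2 isT else o 3 isT.
have h_adj y t : (adj (h y) (h t) = adj y t) /\ (h y = h t -> hamming (g y) (g t) = 0).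
  rewrite (embedding_adj embg) hamm /h.
  have := cst_gk y; have := cst_gk t; have := cst_gj y; have := cst_gj t.
  move: (tnth (f p) i) (tnth (f x) j) (tnth (f z) k) => bi bj bk.
  move: (tnth (g y) i) (tnth (g y) j) (tnth (g y) k) => yi yj yk.
  move: (tnth (g t) i) (tnth (g t) j) (tnth (g t) k) => ti tj tk.
  case: (eqVneq yi bi) => [->|yi_b] tJ yJ tK yK.
    rewrite (yK erefl); case: (eqVneq ti bi) tJ tK => [->|ti_b] tJ tK.
      rewrite (tK erefl) !eqxx.
      by case: yj tj bj {yJ tJ yK tK} => [] [] [].
    rewrite (tJ isT).
    by case: yj tk bj bk {yJ tJ yK tK} => [] [] [] [].
  rewrite (yJ isT); case: (eqVneq ti bi) tJ tK => [->|ti_b] tJ tK.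
    rewrite (tK erefl) yi_b.
    by case: yk tj bj bk {yJ tJ yK tK} => [] [] [] [].
  rewrite (tJ isT) !eqxx; have -> : yi = ti.
    by case: yi ti bi yi_b ti_b {yJ tJ yK tK} => [] [] [].
  by rewrite eqxx; case: yk tk bk {yJ tJ yK tK} => [] [] [].
exists h; split=> [|y t]; last by case: (h_adj y t).
apply: inj_surj_bij => [y t /(h_adj y t).2/eqP|].
  by rewrite hamming_eq0 => /eqP/(embedding_inj embg).
have zp_i : tnth (f z) i != tnth (f p) i by rewrite zq_i.
case=> [[|[|[|[|//]]]]] lt_m.
- have [y [y_i y_j y_k]] := lift p; exists y; apply: val_inj.
  by rewrite /h y_i eqxx y_j eq_sym (negPf xp_j).
- have [y [y_i y_j y_k]] := lift x; exists y; apply: val_inj.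
  by rewrite /h y_i xp_i eqxx y_j eqxx.
- have [y [y_i y_j y_k]] := lift z; exists y; apply: val_inj.
  by rewrite /h y_i (negPf zp_i) y_k eqxx.
- have [y [y_i y_j y_k]] := lift q; exists y; apply: val_inj.
  by rewrite /h y_i (negPf qp_i) y_k eq_sym (negPf zq_k).
Qed.

(** * Halfspaces of a median graph and its cube embedding *)

Section MedianHalfspaces.
Variables (G : sgraph) (medG : median_graph G).
Implicit Types a b w x y z : G.

Let connG : connected G := medG.1.

Lemma median_uniq a b w x y : between a x b -> between a x w -> between b x w ->
  between a y b -> between a y w -> between b y w -> x = y.
Proof.
move=> *; have [z [_ z_uniq]] := medG.2 a b w.
by rewrite -(z_uniq x) ?(z_uniq y).
Qed.

(** Bipartiteness: the median of [a], [b] and [w] lies on the edge, so it is [a] or [b]. *)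
Lemma adj_dist a b w : adj a b ->
  dist b w = (dist a w).+1 \/ dist a w = (dist b w).+1.
Proof.
rewrite -(dist1E connG) => /eqP d1; have [m [[/eqP ab /eqP aw /eqP bw] _]] := medG.2 a b w.
move: ab; rewrite d1; case E: (dist a m) => [|[|//]] => [_|[d_mb]].
  by left; rewrite -bw -(dist_eq0 connG E) (dist_sym connG b) d1.
by right; rewrite -aw E (dist_eq0 connG d_mb) add1n.
Qed.

(** For opposite edges [c d] and [c' d'] of a square, a vertex [w] closer to [c] than to [d] but
    closer to [d'] than to [c'] would have both [c] and [d'] as medians of [w], [d] and [c']. *)
Lemma Wset_square a b a' b' :
    adj a b -> adj a a' -> adj b b' -> adj a' b' -> a != b' -> a' != b ->
  Wset a b = Wset a' b'.
Proof.
suff sub (c d c' d' : G) : adj c d -> adj c c' -> adj d d' -> adj c' d' ->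
    c != d' -> c' != d -> Wset c d \subset Wset c' d'.
  move=> ab aa' bb' a'b' neq neq'; apply/eqP; rewrite eqEsubset !sub //.
  - by rewrite adj_sym.
  - by rewrite adj_sym.
move=> cd cc' dd' c'd' neq neq'; apply/subsetP=> w; rewrite !inE => cd_w.
have [c'd'_w // | d'c'_w] := adj_dist w c'd'; first by rewrite c'd'_w.
case/eqP: neq; apply: (@median_uniq w d c').
all: rewrite /between ?(dist_sym connG w) ?(dist_sym connG d c').
all: rewrite ?(dist_sym connG d c) ?(dist_sym connG d' d).
all: move: cd_w d'c'_w (adj_dist w cd) (adj_dist w cc') (adj_dist w dd') (adj_dist c' cd).
all: move: cd cc' dd' c'd'; rewrite -!(dist1E connG) ?(dist_sym connG d' c').
all: have := contra_neq (@dist_eq0 _ connG c' d) neq'.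
all: rewrite (dist_sym connG d c'); lia.
Qed.

(* Induction along a ladder of squares from the edge a b to the edge x y. *)
Lemma Wset_separated_edge a b x y : adj a b -> adj x y ->
  x \in Wset a b -> y \in Wset b a -> Wset a b = Wset x y.
Proof.
move: {2}(dist a x) (erefl (dist a x)) => k.
elim: k a b => [|k IHk] a b ax ab xy; rewrite !inE => xW yW.
  have eq_ax := dist_eq0 connG ax; subst x.
  have eq_by : b = y.
    apply: (dist_eq0 connG); move: xy yW; rewrite -(dist1E connG); lia.
  by rewrite eq_by.
have neq_ax : a != x by apply: contra_eqN ax => /eqP->; rewrite distxx.
have [a' aa' ax'] := dist_step connG neq_ax.
have da'x : dist a' x = k by lia.
have dbx : dist b x = k.+2 by case: (adj_dist x ab); lia.
have day : dist a y = k.+2.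
  have := adj_dist y ab; have := adj_dist a xy; have := adj_dist b xy.
  by rewrite !(dist_sym connG x) !(dist_sym connG y); lia.
have dby : dist b y = k.+1 by case: (adj_dist y ab); lia.
have da'y : dist a' y = k.+1.
  have := adj_dist y aa'; have := adj_dist a' xy.
  by rewrite !(dist_sym connG x) !(dist_sym connG y); lia.
have neq_a'b : a' != b by apply/eqP=> eq_a'b; move: da'x; rewrite eq_a'b dbx; lia.
have da'b : dist a' b = 2.
  have := contra_neq (@dist_eq0 _ connG a' b) neq_a'b.
  have := adj_dist a' ab; move: aa'; rewrite -(dist1E connG) (dist_sym connG b).
  by move=> /eqP ->; lia.
(* As [a'] and [b] are at distance 2 and equally far from [y], this median is adjacent to both and
   completes the next square of the ladder. *)
have [b' [[/eqP bt1 /eqP bt2 /eqP bt3] _]] := medG.2 a' b y.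
have a'b' : adj a' b' by rewrite -(dist1E connG); move: bt3; rewrite (dist_sym connG b b'); lia.
have bb' : adj b b' by rewrite -(dist1E connG); move: bt3; rewrite (dist_sym connG b b'); lia.
have db'y : dist b' y = k.
  by move: a'b'; rewrite -(dist1E connG) => /eqP d1; lia.
have neq_ab' : a != b' by apply/eqP=> eq_ab'; move: db'y; rewrite -eq_ab' day; lia.
rewrite (Wset_square ab aa' bb' a'b') //; apply: IHk => //; rewrite inE; last by lia.
by have := adj_dist x bb'; lia.
Qed.

Lemma Wset_compl a b w : adj a b -> (w \in Wset b a) = (w \notin Wset a b).
Proof. by move=> ab; have := adj_dist w ab; rewrite !inE; lia. Qed.

Lemma median_cube_embedding : exists n (f : G -> n.-tuple bool),
  cube_embedding f /\ forall i, exists x y, tnth (f x) i != tnth (f y) i.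
Proof.
have /card_gt0P[v0 _] := connG.1.
(* The base vertex [v0] selects one half of each complementary pair, so that each class yields one
   coordinate. *)
pose HS := [set Wset p.1 p.2 | p : G * G & adj p.1 p.2 && (v0 \notin Wset p.1 p.2)].
have HSP W : reflect (exists a b, [/\ adj a b, v0 \notin Wset a b & W = Wset a b]) (W \in HS).
  apply: (iffP imsetP) => [[[a b]] | [a [b [ab v0W ->]]]].
    by rewrite inE => /andP[ab v0W] ->; exists a, b.
  by exists (a, b); rewrite // inE ab.
pose f x : #|HS|.-tuple bool := [tuple x \in enum_val i | i < #|HS|].
have f_in x i : tnth (f x) i = (x \in enum_val i) by rewrite tnth_mktuple.
(* By [Wset_separated_edge], any member of [HS] that separates [x] from [y] is [Wset x y] or
   [Wset y x], and only one of these misses [v0]. *)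
have edgeW x y : adj x y -> exists i,
    (forall j, (tnth (f x) j != tnth (f y) j) = (j == i)) /\
    (enum_val i = Wset x y \/ enum_val i = Wset y x).
  move=> xy; have yx : adj y x by rewrite adj_sym.
  have [W [WH eqW]] : exists W, W \in HS /\ (W = Wset x y \/ W = Wset y x).
    have [v0W|v0W] := boolP (v0 \in Wset x y).
      exists (Wset y x); split; last by right.
      by apply/HSP; exists y, x; rewrite Wset_compl ?negbK.
    by exists (Wset x y); split; [apply/HSP; exists x, y | left].
  have xW : x \in Wset x y.
    by rewrite inE distxx // lt0n; move: yx; rewrite -(dist1E connG) => /eqP->.
  have yW : y \in Wset y x.
    by rewrite inE distxx // lt0n; move: xy; rewrite -(dist1E connG) => /eqP->.
  have x_compl := Wset_compl x xy; have y_compl := Wset_compl y xy.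
  have v0_compl := Wset_compl v0 xy.
  exists (enum_rank_in WH W); rewrite enum_rankK_in //; split=> // j; rewrite !f_in.
  rewrite -(inj_eq enum_val_inj) enum_rankK_in //.
  have /HSP[a [b [ab v0a ->]]] := enum_valP j; have ba : adj b a by rewrite adj_sym.
  have v0W : v0 \notin W by have /HSP[? [? [_ ? ->]]] := WH.
  apply/idP/eqP=> [neq | ->]; last first.
    have xW' : x \notin Wset y x by rewrite x_compl xW.
    have yW' : y \notin Wset x y by rewrite -y_compl.
    by case: eqW => ->; rewrite ?xW ?yW ?(negPf xW') ?(negPf yW').
  have {}neq : Wset a b = Wset x y \/ Wset a b = Wset y x.
    have [xa|xa] := boolP (x \in Wset a b).
      left; apply: Wset_separated_edge => //; rewrite Wset_compl //.
      by move: neq; rewrite xa; case: (y \in _).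
    right; apply: Wset_separated_edge => //; last by rewrite Wset_compl.
    by move: neq; rewrite (negPf xa); case: (y \in _).
  have v0_xor : v0 \notin Wset x y -> v0 \notin Wset y x -> False.
    by rewrite v0_compl => ->.
  by case: neq v0a => -> v0a; case: eqW v0W => -> v0W //; case: v0_xor.
exists #|HS|, f; split; last first.
  move=> i; have /HSP[a [b [ab _ eqW]]] := enum_valP i; exists a, b.
  have ba : adj b a by rewrite adj_sym.
  rewrite !f_in eqW !inE !distxx //.
  by move: ab ba; rewrite -!(dist1E connG) => /eqP-> /eqP->.
split=> [x y /edgeW[i [xy_i _]] | x y neq]; first by apply/eqP/hamming1P; exists i.
have [z xz dz] := dist_step connG neq; exists z => //.
have [i [xz_i eqW]] := edgeW x z xz; have zx : adj z x by rewrite adj_sym.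
have := hamming_flip (f y) xz_i; have := xz_i i; rewrite eqxx.
(* A step towards [y] enters the half that contains [y], so the one changed coordinate now agrees
   with [y]. *)
have yz : y \in Wset z x by rewrite inE dz.
have -> : tnth (f y) i = tnth (f z) i.
  rewrite !f_in; case: eqW => ->; last first.
    by rewrite yz inE distxx // lt0n; move: xz; rewrite -(dist1E connG) => /eqP->.
  rewrite (Wset_compl y zx) yz.
  by rewrite inE distxx // ltn0.
by move=> ->; rewrite eqxx; lia.
Qed.
End MedianHalfspaces.

(** * Degree against the dimension of an embedding *)

Section Degree.
Variables (G : sgraph) (n : nat) (f : G -> n.-tuple bool) (v : G).
Hypothesis embf : cube_embedding f.

Let nbrs := [set w | adj v w].
Let flips := [set flip i (f v) | i : 'I_n].

Lemma flip_inj (a : n.-tuple bool) : injective (fun i => flip i a).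
Proof.
move=> i j eq_ij; have := flip_coord i a j.
by rewrite eq_ij flip_coord eqxx eq_sym => /esym/eqP.
Qed.

Let card_flips : #|flips| = n.
Proof. by rewrite card_imset ?card_ord //; apply: flip_inj. Qed.

Let card_nbrs : #|f @: nbrs| = deg v.
Proof. by rewrite card_imset //; apply: embedding_inj. Qed.

Let nbrs_flips : f @: nbrs \subset flips.
Proof.
apply/subsetP=> _ /imsetP[w + ->]; rewrite inE => vw.
have [i vw_i] := edge_coord embf vw; apply/imsetP; exists i => //.
apply/eq_from_tnth=> j; rewrite tnth_flip -vw_i.
by case: (tnth (f v) j) (tnth (f w) j) => [] [].
Qed.

Lemma deg_le_dim : deg v <= n.
Proof.
by rewrite -card_nbrs; apply: leq_trans (subset_leq_card nbrs_flips) _;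
  rewrite card_flips.
Qed.

(** The neighbours of [v] are mapped injectively into the [n] flips of [f v]; equal cardinality
    means that every flip is attained. *)
Lemma deg_eq_dim :
  deg v = n <-> forall i, exists w, f w = flip i (f v).
Proof.
split=> [deg_n i | all_flips].
  have /eqP eq_f : f @: nbrs == flips.
    by rewrite eqEcard nbrs_flips card_flips card_nbrs deg_n leqnn.
  have : flip i (f v) \in flips by apply: imset_f.
  by rewrite -eq_f => /imsetP[w _ ->]; exists w.
apply/eqP; rewrite eqn_leq deg_le_dim -card_nbrs /=.
apply: leq_trans (eq_leq (esym card_flips)) _; apply: subset_leq_card.
apply/subsetP=> _ /imsetP[i _ ->]; have [w fw] := all_flips i.
by apply/imsetP; exists w; rewrite // inE (embedding_adj embf) fw hamming_flip1.
Qed.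
End Degree.

(** * Vertices of full degree and simplex graphs *)

Lemma peripheral_full_degree (G : sgraph) : median_graph G ->
    (forall C : {set {set G}}, is_Theta_class C -> peripheral C) ->
  exists v : G, is_idim G (deg v).
Proof.
move=> medG periG; have connG := medG.1.
have [n [f [embf ncst]]] := median_cube_embedding medG.
(* The value [b] marks the peripheral side of [i]. *)
have side i : exists b, forall x, tnth (f x) i = b ->
    exists2 y, adj x y & tnth (f y) i != b.
  have [x0 [y0 /(coord_separating_edge embf)[u [v [uv _ uv_i]]]]] := ncst i.
  have [|a [b [ab eqC UW]]] := periG (edge_set (Theta u v)); first by exists u, v.
  have [k ab_k] := edge_coord embf ab.
  have ab_F : [set a; b] \in Fset a b by rewrite (in_Fset connG embf _ _ ab_k) ab ab_k eqxx.
  have eq_ik : i = k.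
    apply/eqP; rewrite -ab_k; move: ab_F.
    by rewrite -eqC (in_Theta_class connG embf _ _ uv_i) => /andP[].
  have {eq_ik} ab_i j : (tnth (f a) j != tnth (f b) j) = (j == i) by rewrite eq_ik.
  have ba_i j : (tnth (f b) j != tnth (f a) j) = (j == i) by rewrite eq_sym.
  have crossing c d : (forall j, (tnth (f c) j != tnth (f d) j) = (j == i)) ->
      Uset c d = Wset c d -> exists b, forall x, tnth (f x) i = b ->
      exists2 y, adj x y & tnth (f y) i != b.
    move=> cd_i eqUW; exists (tnth (f c) i) => x xc_i.
    have : x \in Uset c d by rewrite eqUW (Wset_coord connG embf _ cd_i) xc_i.
    rewrite (in_Uset connG embf _ cd_i) => /andP[_ /existsP[y /andP[xy xy_i]]].
    by exists y; rewrite // -xc_i eq_sym.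
  by case: UW; apply: crossing.
have {side} [c sideP] := fin_all_exists side.
(* Recoding by [D] makes the peripheral side the value one; crossing away from it deletes a single
   element. *)
pose D x := [set i | tnth (f x) i == c i].
have D_down x (S : {set 'I_n}) : S \subset D x -> exists y, D y = S.
  apply: delete_closed_subset => {}x i; rewrite inE => /eqP xc_i.
  have [y xy yc_i] := sideP _ _ xc_i; have [k xy_k] := edge_coord embf xy.
  have eq_ik : i = k by apply/eqP; rewrite -xy_k xc_i eq_sym.
  subst k; exists y; apply/setP=> j; have := xy_k j; rewrite !inE.
  case: (eqVneq j i) => [->|_]; first by rewrite (negPf yc_i).
  by case: (tnth (f x) j) (tnth (f y) j) => [] [].
have [x0 _] : exists x0 : G, true by have /card_gt0P[x0] := connG.1; exists x0.
have [v Dv] := D_down x0 set0 (sub0set _).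
have deg_v : deg v = n.
  apply/(deg_eq_dim v embf) => i.
  have [x ix] : exists x, i \in D x.
    have [x [y xy_i]] := ncst i; have [xc|xc] := boolP (i \in D x); first by exists x.
    by exists y; move: xc xy_i; rewrite !inE; case: (tnth _ _) (tnth _ _) (c i) => [] [] [].
  have [w Dw] : exists w, D w = [set i] by apply: (D_down x); rewrite sub1set.
  exists w; apply/eq_from_tnth=> j; rewrite tnth_flip.
  have /setP/(_ j) := Dv; have /setP/(_ j) := Dw; rewrite !inE.
  by case: (tnth (f w) j) (tnth (f v) j) (c j) (j == i) => [] [] [] [].
exists v; rewrite deg_v; split=> [|m [_ [g isog]]].
  by split=> //; exists f; apply: embedding_isometric.
(* The degree is a lower bound for the dimension of every isometric embedding, so [n] is least. *)
by rewrite -deg_v; apply: deg_le_dim (isometric_cube_embedding connG isog).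
Qed.

(* Recentred at v, the image of the embedding contains the empty set and all
   singletons; closure under medians makes it downward closed and determined by
   its two-element sets. *)
Lemma full_degree_simplex_graph (G : sgraph) (v : G) n : median_graph G ->
  deg v = n -> isometric_in_cube G n -> is_simplex_graph G.
Proof.
move=> medG deg_n [connG [f isof]].
have embf := isometric_cube_embedding connG isof.
pose s x := [set i | tnth (f x) i != tnth (f v) i].
have s_inj : injective s.
  move=> x y /setP eq_s; apply: (embedding_inj embf); apply/eq_from_tnth=> i.
  have := eq_s i; rewrite !inE.
  by case: (tnth (f x) i) (tnth (f y) i) (tnth (f v) i) => [] [] [].
have hamm x y : hamming (f x) (f y) = #|[set i | (i \in s x) != (i \in s y)]|.
  apply: eq_card => i; rewrite !inE.
  by case: (tnth (f x) i) (tnth (f y) i) (tnth (f v) i) => [] [] [].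
have sv : s v = set0 by apply/setP=> i; rewrite !inE eqxx.
have s1 i : exists e, s e = [set i].
  have [e fe] := (deg_eq_dim v embf).1 deg_n i; exists e; apply/setP=> j.
  by rewrite !inE fe eq_sym flip_coord.
have s_med x y z : exists m, forall i,
    (i \in s m) = if (i \in s x) == (i \in s y) then i \in s x else i \in s z.
  have [m fm] := embedding_median x y z medG embf; exists m => i.
  rewrite !inE fm.
  by case: (tnth (f x) i) (tnth (f y) i) (tnth (f z) i) (tnth (f v) i) => [] [] [] [].
(* A step towards [v] deletes some [j]. If it is not [i], induction also deletes [i], and the
   majority of the result, [s x] and the singleton of [j] restores [j] alone. *)
have s_del x i : i \in s x -> exists y, s y = s x :\ i.
  move: {2}#|s x| (leqnn #|s x|) => m; elim: m x => [|m IHm] x.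
    by rewrite leqn0 cards_eq0 => /eqP->; rewrite inE.
  move=> le_m ix; have neq_xv : x != v by apply: contraTneq ix => ->; rewrite sv inE.
  have [z [j [xz xz_j xv_j _]]] := embedding_step embf neq_xv.
  have jx : j \in s x by rewrite inE.
  have sz : s z = s x :\ j.
    apply/setP=> k; have := xz_j k; move: xv_j; rewrite !inE.
    case: (eqVneq k j) => [->|_].
      by case: (tnth (f x) j) (tnth (f z) j) (tnth (f v) j) => [] [] [].
    by case: (tnth (f x) k) (tnth (f z) k) (tnth (f v) k) => [] [] [].
  have [->|neq_ij] := eqVneq i j; first by exists z.
  have [||y sy] := IHm z; first by move: le_m; rewrite (cardsD1 j) jx -sz.
    by rewrite sz in_setD1 neq_ij.
  have [e se] := s1 j; have [t st] := s_med y x e; exists t; apply/setP=> k.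
  rewrite st sy sz se !in_setD1 in_set1.
  case: (eqVneq k i) => [->|ki]; first by rewrite (negPf neq_ij); case: (_ \in _).
  case: (eqVneq k j) => [->|kj]; first by rewrite jx.
  by rewrite eqxx.
pose e i j := (i != j) && [exists x, s x == [set i; j]].
have e_sym : symmetric e.
  by move=> i j; rewrite /e eq_sym; congr (_ && _); apply: eq_existsb => x; rewrite setUC.
have e_irr : irreflexive e by move=> i; rewrite /e eqxx.
pose H := SGraph e_sym e_irr.
have s_clique x : @clique H (s x).
  apply/forall_inP=> i ix; apply/forall_inP=> j jx; apply/implyP=> neq_ij.
  have [|y sy] := delete_closed_subset s_del (_ : [set i; j] \subset s x).
    by rewrite subUset !sub1set ix.
  by rewrite /= /e neq_ij; apply/existsP; exists y; rewrite sy.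
(* For distinct [i] and [j] in [A], the majority of [A :\ i], [A :\ j] and [[set i; j]] is [A]. *)
have clique_s (A : {set H}) : clique A -> exists x, s x = A.
  move: {2}#|A| (leqnn #|A|) => m; elim: m A => [|m IHm] A.
    by rewrite leqn0 cards_eq0 => /eqP-> _; exists v.
  move=> le_m clA.
  have cl_del i : i \in A -> exists x, s x = A :\ i.
    move=> iA; apply: IHm; first by move: le_m; rewrite (cardsD1 i) iA.
    apply/forall_inP=> j; rewrite !inE => /andP[_ jA]; apply/forall_inP=> k.
    rewrite !inE => /andP[_ kA].
    by have /forall_inP/(_ j jA)/forall_inP/(_ k kA) := clA.
  have [->|[i iA]] := set_0Vmem A; first by exists v.
  have [A1|[j]] := set_0Vmem (A :\ i).
    by have [x sx] := s1 i; exists x; rewrite sx -(setD1K iA) A1 setU0.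
  rewrite !inE => /andP[neq_ji jA].
  have /forall_inP/(_ i iA)/forall_inP/(_ j jA)/implyP := clA.
  rewrite eq_sym => /(_ neq_ji) /andP[_ /existsP[t /eqP st]].
  have [x sx] := cl_del i iA; have [y sy] := cl_del j jA.
  have [w sw] := s_med x y t; exists w; apply/setP=> k.
  rewrite sw sx sy st !in_setD1 in_set2.
  case: (eqVneq k i) => [->|ki]; first by rewrite iA (eq_sym i j) (negPf neq_ji).
  case: (eqVneq k j) => [->|kj]; first by rewrite jA.
  by rewrite eqxx.
pose h x : simplex_graph H := exist (fun A : {set H} => clique A) (s x) (s_clique x).
exists H, h; split=> [|x y]; last first.
  by rewrite (embedding_adj embf) hamm -(@adds_vertexE H).
apply: inj_surj_bij => [x y /(congr1 val)/s_inj // | [A clA]].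
by have [x sx] := clique_s A clA; exists x; apply: val_inj.
Qed.

Theorem theorem1 (G : sgraph) (G_median : median_graph G) :
  [<-> is_simplex_graph G;
       is_daisy_cube G;
       pc_minor_free (fun K => K = P4) G;
       forall C : {set {set G}}, is_Theta_class C -> peripheral C;
       exists v : G, is_idim G (deg v)].
Proof.
tfae.
- exact: simplex_graph_daisy_cube.
- exact: daisy_cube_P4_free G_median.1.
- exact: P4_free_peripheral.
- exact: peripheral_full_degree.
- by case=> v [isoG _]; apply: full_degree_simplex_graph erefl isoG.
Qed.
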